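(* For every real $a>1$, $$\sum_{k=1}^{\infty}\frac{1}{1-a^{2k+1}}=\frac{1}{a-1}-\frac{\psi_{1/a^{2}}(1)}{2\ln a}+\frac{\psi_{1/a}(1)}{\ln a}+\frac{\ln\left(\frac{a-1}{a+1}\right)}{2\ln a}.$$
   Context: For $0<q<1$, $\psi_q$ denotes the $q$-digamma function, defined by $$\psi_q(z)=-\ln(1-q)+\ln(q)\sum_{k=0}^{\infty}\frac{q^{k+z}}{1-q^{k+z}} .$$ *)

(* Defs.v *)
From Stdlib Require Import Reals.
From Coquelicot Require Import Coquelicot.
Open Scope R_scope.

(** The q-digamma function at a real argument z, for 0 < q < 1.  [Rpower] is
    the real power [exp (y * ln q)], so it is meaningful only for q > 0. *)
Definition q_digamma (q z : R) : R :=
  - ln (1 - q)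
  + ln q * Series (fun k : nat =>
      Rpower q (INR k + z) / (1 - Rpower q (INR k + z))).

(* Main.v *)
Require Import Defs.
From Stdlib Require Import Reals Lra Lia.
From Coquelicot Require Import Coquelicot.
Open Scope R_scope.

(** Write [L(q)] for the Lambert series, the sum of [q^n / (1 - q^n)] over
    [n >= 1].  At [z = 1] the q-digamma function is
    [- ln (1 - q) + ln q * L(q)] ([q_digamma_1]).  Take [q = 1/a], so that
    [q^n / (1 - q^n) = 1 / (a^n - 1)].  The terms of [L(q)] with even [n] are
    exactly the terms of [L(q^2)], hence [L(q) - L(q^2)] is the sum over odd
    [n] ([is_series_even_terms]).  The summand of the theorem at index [k >= 1]
    is the opposite of the term [n = 2k + 1], so its sum is
    [1/(a - 1) - L(q) + L(q^2)], where [1/(a - 1)] is the term [n = 1].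

    On the right-hand side, [ln (1/a^2) = - 2 ln a] and [ln (1/a) = - ln a]
    turn the two q-digamma values into [L(q^2) - L(q)] plus logarithms.
    Multiplied by [2 ln a], these and the explicit logarithm add up to
    [ln (1 - q^2) - 2 ln (1 - q) + ln ((1 - q) / (1 + q))], which vanishes
    because [1 - q^2 = (1 - q)(1 + q)]. *)

Definition lambert_term (q : R) (k : nat) : R := q ^ S k / (1 - q ^ S k).

Lemma pow_S_le (q : R) (k : nat) : 0 < q < 1 -> 0 < q ^ S k <= q.
Proof.
  intros Hq; split; [apply pow_lt; lra|].
  assert (H : q ^ k <= 1) by (rewrite <- (pow1 k); apply pow_incr; lra).
  simpl; nra.
Qed.

(** Since [q^n <= q] for [n >= 1], the series is dominated by
    [1 / (1 - q)] times the geometric series of the [q^n]. *)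
Lemma ex_series_lambert (q : R) : 0 < q < 1 -> ex_series (lambert_term q).
Proof.
  intros Hq.
  apply (@ex_series_le R_AbsRing R_CompleteNormedModule _
           (fun k => q / (1 - q) * q ^ k)).
  - intros k. unfold lambert_term.
    pose proof (pow_S_le q k Hq) as Hk.
    change (Rabs (q ^ S k / (1 - q ^ S k)) <= q / (1 - q) * q ^ k).
    rewrite Rabs_pos_eq.
    + replace (q / (1 - q) * q ^ k) with (q ^ S k / (1 - q))
        by (simpl; field; lra).
      apply Rmult_le_compat_l; [lra|].
      apply Rinv_le_contravar; lra.
    + apply Rlt_le, Rdiv_lt_0_compat; lra.
  - apply (ex_series_scal_l (q / (1 - q)) (fun k => q ^ k)).
    apply ex_series_geom. rewrite Rabs_pos_eq; lra.
Qed.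

Lemma q_digamma_1 (q : R) : 0 < q < 1 ->
  q_digamma q 1 = - ln (1 - q) + ln q * Series (lambert_term q).
Proof.
  intros Hq. unfold q_digamma. f_equal. f_equal.
  apply Series_ext; intros k. unfold lambert_term.
  rewrite <- S_INR, Rpower_pow by lra. reflexivity.
Qed.

(** The partial sums of [u] of length [2n + 2] split into those of the even
    and odd positions; the former are a subsequence of all partial sums of
    [u]. *)
Lemma is_series_even_terms (u : nat -> R) (s t : R) :
  is_series u s -> is_series (fun k => u (2 * k + 1)%nat) t ->
  is_series (fun k => u (2 * k)%nat) (s - t).
Proof.
  intros Hs Ht.
  assert (Hs' : is_lim_seq (sum_n u) s) by exact Hs.
  assert (Ht' : is_lim_seq (sum_n (fun k => u (2 * k + 1)%nat)) t) by exact Ht.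
  assert (Hsub : is_lim_seq (fun n => sum_n u (2 * n + 1)%nat) s).
  { apply (is_lim_seq_subseq (sum_n u) s (fun n => (2 * n + 1)%nat)); auto.
    apply eventually_subseq; intros n; lia. }
  change (is_lim_seq (sum_n (fun k => u (2 * k)%nat)) (s - t)).
  apply is_lim_seq_ext with
    (fun n => sum_n u (2 * n + 1)%nat - sum_n (fun k => u (2 * k + 1)%nat) n).
  - intros n. induction n as [|n IH].
    + change (2 * 0 + 1)%nat with 1%nat.
      rewrite sum_Sn, !sum_O. change plus with Rplus. simpl. ring.
    + replace (2 * S n + 1)%nat with (S (S (2 * n + 1))) by lia.
      rewrite !sum_Sn, <- IH. change plus with Rplus.
      replace (2 * S n + 1)%nat with (S (S (2 * n + 1))) by lia.
      replace (2 * S n)%nat with (S (2 * n + 1)) by lia.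
      simpl. ring.
  - apply is_lim_seq_minus'; assumption.
Qed.

Lemma lambert_term_sqr (q : R) (k : nat) :
  lambert_term (q ^ 2) k = lambert_term q (2 * k + 1).
Proof.
  unfold lambert_term. rewrite <- pow_mult.
  replace (2 * S k)%nat with (S (2 * k + 1)) by lia. reflexivity.
Qed.

Lemma lambert_term_inv (a : R) (k : nat) : 1 < a ->
  lambert_term (1 / a) k = 1 / (a ^ S k - 1).
Proof.
  intros Ha. unfold lambert_term, Rdiv. rewrite !Rmult_1_l, pow_inv.
  assert (H : 1 < a ^ S k) by (apply Rlt_pow_R1; [exact Ha | lia]).
  field. lra.
Qed.

(* The summation index k >= 1 is written [S k] with k >= 0. *)
Theorem mainTheorem4 (a : R) (ha : 1 < a) :
  is_series (fun k : nat => 1 / (1 - a ^ (2 * S k + 1)))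
    (1 / (a - 1)
     - q_digamma (1 / a ^ 2) 1 / (2 * ln a)
     + q_digamma (1 / a) 1 / ln a
     + ln ((a - 1) / (a + 1)) / (2 * ln a)).
Proof.
  set (q := 1 / a).
  assert (Hq : 0 < q < 1).
  { unfold q; split; [apply Rdiv_lt_0_compat; lra|].
    apply Rlt_div_l; lra. }
  assert (Hq2 : 0 < q ^ 2 < 1) by (simpl; nra).
  assert (HL : 0 < ln a) by (rewrite <- ln_1; apply ln_increasing; lra).
  assert (Hlnq : ln q = - ln a).
  { unfold q, Rdiv. rewrite Rmult_1_l. apply ln_Rinv; lra. }
  replace (1 / a ^ 2) with (q ^ 2) by (unfold q; field; lra).
  rewrite !q_digamma_1 by assumption.
  pose proof (Series_correct _ (ex_series_lambert q Hq)) as Hs.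
  pose proof (Series_correct _ (ex_series_lambert (q ^ 2) Hq2)) as Ht.
  set (s := Series (lambert_term q)) in *.
  set (t := Series (lambert_term (q ^ 2))) in *.
  assert (Hodd : is_series (fun k => - lambert_term q (2 * S k)%nat)
                   (- (s - t - 1 / (a - 1)))).
  { apply (is_series_opp (fun k => lambert_term q (2 * S k)%nat)).
    apply (is_series_incr_1 (fun k => lambert_term q (2 * k)%nat)).
    match goal with |- is_series _ ?v => replace v with (s - t) end.
    - apply is_series_even_terms; [exact Hs|].
      apply is_series_ext with (2 := Ht). intros k. apply lambert_term_sqr.
    - change plus with Rplus. unfold q. rewrite lambert_term_inv by exact ha.
      change (S (2 * 0)) with 1%nat. rewrite pow_1. ring. }
  (* The logarithms cancel, leaving only the Lambert series. *)
  match goal with |- is_series _ ?v =>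
    replace v with (- (s - t - 1 / (a - 1))) end.
  - apply is_series_ext with (2 := Hodd). intros k.
    unfold q. rewrite lambert_term_inv by exact ha.
    replace (2 * S k + 1)%nat with (S (2 * S k)) by lia.
    assert (H : 1 < a ^ S (2 * S k)) by (apply Rlt_pow_R1; [exact ha | lia]).
    match goal with |- ?x = ?y => change (@eq R x y) end.
    field. lra.
  - replace ((a - 1) / (a + 1)) with ((1 - q) / (1 + q))
      by (unfold q; field; lra).
    rewrite ln_div by lra.
    replace (1 - q ^ 2) with ((1 - q) * (1 + q)) by ring.
    rewrite ln_mult by lra.
    replace (ln (q ^ 2)) with (- 2 * ln a)
      by (rewrite ln_pow by lra; rewrite Hlnq; simpl; ring).
    rewrite Hlnq. field. lra.
Qed.
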